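(* Let $A_n\in\mathbb{R}^{n\times n}$ be a symmetric positive definite Toeplitz matrix with main diagonal entry $a_0$, let $\mathbf y\in\mathbb{R}^n$ with $\mathbf y\ne 0$, and let $\mathcal{N}_\theta:\mathbb{R}^n\to\mathbb{R}^n$ be a neural network solver (a map from $\mathbb{R}^n$ to $\mathbb{R}^n$). Let $M_n\in\mathbb{R}^{n\times n}$ be invertible and suppose that $S_n=I_n-M_n^{-1}A_n$ satisfies the smoothing condition: for some $\delta_1>0$, $$\|S_n\mathbf e\|_{A_n}^2\le\|\mathbf e\|_{A_n}^2-\frac{\delta_1}{a_0}\|\mathbf e\|_{A_n^2}^2\qquad\text{for all }\mathbf e\in\mathbb{R}^n .$$ Let $\mathbf x_\tau$, $\tau=0,1,\dots$, be the sequence generated by the hybrid iteration described in the context (one neural operator correction step followed by one post-smoothing step, and no pre-smoothing), and for an iterate $\mathbf x_\tau$ from which $\mathbf x_{\tau+1}$ is generated put $$\mathbf r=\frac{\mathbf y-A_n\mathbf x_\tau}{\|\mathbf y-A_n\mathbf x_\tau\|_2}.$$ Then $$\|\mathbf x_{\tau+1}-A_n^{-1}\mathbf y\|_{A_n}^2\le\left(1-\frac{\delta_1}{\delta_2}\right)\delta_3\,\|\mathbf x_\tau-A_n^{-1}\mathbf y\|_{A_n}^2$$ if $\mathcal{N}_\theta$ satisfies: 1. (correcting condition) $\|\mathcal{N}_\theta(\mathbf r)-A_n^{-1}\mathbf r\|_{A_n}^2\le\frac{\delta_2}{a_0}\|\mathcal{N}_\theta(\mathbf r)-A_n^{-1}\mathbf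 r\|_{A_n^2}^2$ for some $\delta_2>0$; 2. (stability condition) $\|\mathcal{N}_\theta(\mathbf r)-A_n^{-1}\mathbf r\|_{A_n}^2\le\delta_3\|A_n^{-1}\mathbf r\|_{A_n}^2$ for some $\delta_3>0$.
   Context: Notation: for a symmetric positive definite matrix $B$, $\|\mathbf v\|_B^2=\mathbf v^\top B\mathbf v$; $\|\cdot\|_2$ is the Euclidean norm; $I_n$ is the identity matrix. Hybrid iteration for $A_n\mathbf x=\mathbf y$ with tolerance $\varepsilon>0$: start from $\mathbf x_0=0$. While $\|\mathbf y-A_n\mathbf x_\tau\|_2/\|\mathbf y\|_2\ge\varepsilon$ (so in particular $\mathbf y-A_n\mathbf x_\tau\neq0$), set $$Z_\tau=\|\mathbf y-A_n\mathbf x_\tau\|_2,\qquad \mathbf r_\tau=(\mathbf y-A_n\mathbf x_\tau)/Z_\tau,$$ $$\hat{\mathbf x}_\tau=\mathcal{N}_\theta(\mathbf r_\tau)\,Z_\tau+\mathbf x_\tau \quad\text{(neural operator correction)},$$ $$\mathbf x_{\tau+1}=(I_n-M_n^{-1}A_n)\hat{\mathbf x}_\tau+M_n^{-1}\mathbf y\quad\text{(one post-smoothing step)}.$$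
   Formalization: Added assumption: if the network solves exactly at r, i.e. N(r) = A_n^{-1} r, then δ1 ≤ δ2. Without it the claim fails, since conditions 1 and 2 then hold even for δ2 < δ1 while the right-hand side is negative and the left-hand side is 0. *)

(* Defs.v *)
From HB Require Import structures.
From mathcomp Require Export all_boot all_order all_algebra.
From mathcomp Require Export reals.

Set Implicit Arguments.
Unset Strict Implicit.
Unset Printing Implicit Defensive.

Import GRing.Theory Num.Theory.
Local Open Scope ring_scope.

Definition is_toeplitz (R : realType) (n : nat) (a : int -> R) (A : 'M[R]_n) :
  Prop := forall i j : 'I_n, A i j = a (i%:Z - j%:Z).

(* The squared weighted norm  ||v||_B^2 = v^T B v. *)
Definition normsq (R : realType) (n : nat) (B : 'M[R]_n) (v : 'cV[R]_n) : R :=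
  (v^T *m B *m v) 0 0.

Definition is_spd (R : realType) (n : nat) (B : 'M[R]_n) : Prop :=
  B^T = B /\ forall v : 'cV[R]_n, v != 0 -> 0 < normsq B v.

(* Euclidean norm (the norm that MathComp-Analysis puts on matrices is the
   sup norm). *)
Definition norm2 (R : realType) (n : nat) (v : 'cV[R]_n) : R :=
  Num.sqrt (\sum_(i < n) v i 0 ^+ 2).

Section Hybrid.
Variables (R : realType) (n : nat).
Variables (A M : 'M[R]_n) (N : 'cV[R]_n -> 'cV[R]_n) (y : 'cV[R]_n).

Definition residual (x : 'cV[R]_n) : 'cV[R]_n := y - A *m x.

Definition unit_residual (x : 'cV[R]_n) : 'cV[R]_n :=
  (norm2 (residual x))^-1 *: residual x.

Definition neural_correction (x : 'cV[R]_n) : 'cV[R]_n :=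
  norm2 (residual x) *: N (unit_residual x) + x.

Definition smoothing_step (x : 'cV[R]_n) : 'cV[R]_n :=
  (1%:M - invmx M *m A) *m x + invmx M *m y.

Definition hybrid_step (x : 'cV[R]_n) : 'cV[R]_n :=
  smoothing_step (neural_correction x).

(* The recurrence without its stopping test; [hybrid_iterate tau] is an iterate
   of the algorithm only as long as the loop has not stopped before. *)
Definition hybrid_iterate (tau : nat) : 'cV[R]_n := iter tau hybrid_step 0.

(* The loop guard holds at x_0, ..., x_tau, i.e. the algorithm with tolerance
   eps generates x_(tau + 1) from x_tau. *)
Definition hybrid_generates_next (eps : R) (tau : nat) : Prop :=
  forall k : nat, (k <= tau)%N ->
    eps <= norm2 (residual (hybrid_iterate k)) / norm2 y.

End Hybrid.

(* Main.v *)
Require Import Defs.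
From mathcomp Require Import lra.

Set Implicit Arguments.
Unset Strict Implicit.
Unset Printing Implicit Defensive.

Import Order.TTheory GRing.Theory Num.Theory.
Local Open Scope ring_scope.

(** Write [e] for the error [x tau - invmx A *m y], [Z] for the Euclidean norm
    of the residual at [x tau], [S] for [1%:M - invmx M *m A] and [d] for
    [N r - invmx A *m r].  The residual is [- A *m e], so [e] is
    [- (Z *: (invmx A *m r))]: solving for the unit residual [r] and scaling
    the answer by [Z] would remove the error.  The network solves for [r] only
    up to [d], so its correction replaces [e] by [Z *: d]; the post-smoothing
    fixes the solution and so sends this to [S *m (Z *: d)]
    ([residual_solution], [hybrid_step_error]).

    The two bounds then multiply.  The correcting condition says that [d] lies
    where smoothing is effective: the decrease guaranteed by the smoothing
    condition is at least a fraction [delta1 / delta2] of [normsq A d]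
    ([smoothing_contraction]).  The stability condition compares [normsq A d]
    with [normsq A (invmx A *m r)], which is [normsq A e] up to the factor
    [Z ^+ 2].

    Chaining them requires [0 <= 1 - delta1 / delta2].  When [d != 0] this
    follows from the first bound itself, because the smoothed error has
    nonnegative energy while [normsq A d] is positive
    ([smoothing_factor_ge0]); when [d = 0] it is assumed. *)

Lemma normsqZ (R : realType) (n : nat) (B : 'M[R]_n) (c : R) (v : 'cV[R]_n) :
  normsq B (c *: v) = c ^+ 2 * normsq B v.
Proof.
by rewrite /normsq -scalemxAr linearZ /= -!scalemxAl scalerA -expr2 mxE.
Qed.

Lemma normsqN (R : realType) (n : nat) (B : 'M[R]_n) (v : 'cV[R]_n) :
  normsq B (- v) = normsq B v.
Proof. by rewrite -scaleN1r normsqZ sqrrN expr1n mul1r. Qed.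

Lemma spd_normsq_ge0 (R : realType) (n : nat) (A : 'M[R]_n) (v : 'cV[R]_n) :
  is_spd A -> 0 <= normsq A v.
Proof.
case=> _ A_pos; have [->|/A_pos/ltW //] := eqVneq v 0.
by rewrite -(scale0r 0) normsqZ expr0n mul0r.
Qed.

Lemma spd_unitmx (R : realType) (n : nat) (A : 'M[R]_n) :
  is_spd A -> A \in unitmx.
Proof.
case=> _ A_pos; rewrite -row_free_unit; apply: inj_row_free => v vA0.
apply/eqP/negPn/negP => v_neq0.
have /A_pos : v^T != 0 by rewrite -(inj_eq trmx_inj) trmxK trmx0.
by rewrite /normsq trmxK vA0 mul0mx mxE ltxx.
Qed.

Section Smoothing.
Variables (R : realType) (n : nat) (A S : 'M[R]_n) (a0 delta1 delta2 : R).
Hypotheses (delta1_gt0 : 0 < delta1) (delta2_gt0 : 0 < delta2).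
Hypothesis smoothing : forall e : 'cV[R]_n,
  normsq A (S *m e) <= normsq A e - delta1 / a0 * normsq (A *m A) e.

(** The correcting condition, multiplied by [delta1 / delta2], bounds the
    decrease in the smoothing condition from below by a multiple of
    [normsq A d], eliminating the norm of [A *m A]. *)
Lemma smoothing_contraction (d : 'cV[R]_n) :
  normsq A d <= delta2 / a0 * normsq (A *m A) d ->
  normsq A (S *m d) <= (1 - delta1 / delta2) * normsq A d.
Proof.
move=> correcting; apply: le_trans (smoothing d) _.
have ratio_ge0 : 0 <= delta1 / delta2 by rewrite divr_ge0 // ltW.
have := ler_wpM2l ratio_ge0 correcting.
have -> : delta1 / delta2 * (delta2 / a0 * normsq (A *m A) d)
          = delta1 / a0 * normsq (A *m A) d.
  by rewrite !mulrA divfK // gt_eqF.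
by lra.
Qed.

(** A negative factor would give the smoothed [d] a negative energy. *)
Lemma smoothing_factor_ge0 (d : 'cV[R]_n) :
  is_spd A -> d != 0 ->
  normsq A d <= delta2 / a0 * normsq (A *m A) d ->
  0 <= 1 - delta1 / delta2.
Proof.
move=> A_spd d_neq0 /smoothing_contraction contr.
have d_pos : 0 < normsq A d by case: A_spd => _; apply.
rewrite -(pmulr_lge0 _ d_pos).
exact: le_trans (spd_normsq_ge0 _ A_spd) contr.
Qed.

End Smoothing.

Section HybridError.
Variables (R : realType) (n : nat) (A M : 'M[R]_n).
Variables (N : 'cV[R]_n -> 'cV[R]_n) (y x : 'cV[R]_n).
Hypotheses (A_unit : A \in unitmx) (Z_neq0 : norm2 (residual A y x) != 0).

Let r := unit_residual A y x.
Let Z := norm2 (residual A y x).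

Lemma residual_solution : x - invmx A *m y = - (Z *: (invmx A *m r)).
Proof.
rewrite /r /unit_residual -scalemxAr scalerA divff // scale1r /residual.
by rewrite mulmxBr mulKmx // opprB.
Qed.

Lemma hybrid_step_error :
  hybrid_step A M N y x - invmx A *m y
  = (1%:M - invmx M *m A) *m (Z *: (N r - invmx A *m r)).
Proof.
have -> : Z *: (N r - invmx A *m r) = neural_correction A N y x - invmx A *m y.
  by rewrite /neural_correction -addrA residual_solution scalerBr.
rewrite /hybrid_step /smoothing_step mulmxBr -addrA; congr (_ + _).
(* the exact solution is a fixed point of the smoother *)
by rewrite mulmxBl mul1mx -mulmxA mulKVmx // opprB.
Qed.

End HybridError.

Theorem theorem4p3 (R : realType) (n : nat)
    (A : 'M[R]_n) (a : int -> R) (y : 'cV[R]_n) (N : 'cV[R]_n -> 'cV[R]_n)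
    (M : 'M[R]_n) (eps delta1 delta2 delta3 : R) (tau : nat)
    (A_toeplitz : is_toeplitz a A)
    (A_spd : is_spd A)
    (y_neq0 : y != 0)
    (M_unit : M \in unitmx)
    (eps_gt0 : 0 < eps)
    (delta1_gt0 : 0 < delta1)
    (smoothing : forall e : 'cV[R]_n,
       normsq A ((1%:M - invmx M *m A) *m e)
         <= normsq A e - delta1 / a 0 * normsq (A *m A) e)
    (generates : hybrid_generates_next A M N y eps tau) :
  let x := hybrid_iterate A M N y in
  let r := unit_residual A y (x tau) in
  let d := N r - invmx A *m r in
  forall (delta2_gt0 : 0 < delta2)
    (correcting : normsq A d <= delta2 / a 0 * normsq (A *m A) d)
    (delta3_gt0 : 0 < delta3)
    (stability : normsq A d <= delta3 * normsq A (invmx A *m r))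
    (* If N solves for r exactly, [correcting] holds for every delta2 > 0 and
       the factor 1 - delta1 / delta2 could be negative while the left-hand
       side below is 0. *)
    (exact_case : d = 0 -> delta1 <= delta2),
  normsq A (x tau.+1 - invmx A *m y)
    <= (1 - delta1 / delta2) * delta3 * normsq A (x tau - invmx A *m y).
Proof.
move=> x r d delta2_gt0 correcting delta3_gt0 stability exact_case.
have A_unit := spd_unitmx A_spd.
have Z_neq0 : norm2 (residual A y (x tau)) != 0.
  apply: contraTneq (generates tau (leqnn _)) => Z_eq0.
  by rewrite -/(x tau) Z_eq0 mul0r -ltNge.
have factor_ge0 : 0 <= 1 - delta1 / delta2.
  have [/exact_case le12|d_neq0] := eqVneq d 0.
    by rewrite subr_ge0 ler_pdivrMr // mul1r.
  exact: (smoothing_factor_ge0 delta1_gt0 delta2_gt0 smoothing A_spd d_neq0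
            correcting).
have -> : x tau.+1 = hybrid_step A M N y (x tau) by [].
rewrite hybrid_step_error // (residual_solution A_unit Z_neq0) -/r -/d -scalemxAr.
rewrite normsqN !normsqZ mulrCA ler_wpM2l ?sqr_ge0 // -mulrA.
apply: le_trans (smoothing_contraction delta1_gt0 delta2_gt0 smoothing
                   correcting) _.
by rewrite ler_wpM2l.
Qed.
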